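(* Let $X_1,X_2,\ldots$ be i.i.d. from $g$, and consider the problems $(\mathcal P)$ and $(\mathcal P_n)$ defined in the context. Suppose that: (1) for every $L\in\mathcal L$ the random variables $\phi_j(X)L(X)$, $j=0,\ldots,l$, are integrable with respect to $g$; (2) $\mathcal L$ is a convex set; (3) there exists $L_0\in\mathcal L$ such that $\mathbb E_g[\phi_j(X)L_0(X)]<\mu_j$ for $j=1,\ldots,m$ and $\mathbb E_g[\phi_j(X)L_0(X)]=\mu_j$ for $j=m+1,\ldots,l$, and moreover $(\mu_{m+1},\ldots,\mu_l)$ is an interior point of $\{(\mathbb E_g[\phi_{m+1}(X)L(X)],\ldots,\mathbb E_g[\phi_l(X)L(X)]):L\in\mathcal L\}\subset\mathbb R^{l-m}$; (4) $val(\mathcal P)$ is finite; (5) for each $j=0,\ldots,l$ the function class $\mathcal F_j:=\{\phi_j(x)L(x):L\in\mathcal L\}$ has an integrable envelope (with respect to $P_g$) and is $P_g$-Glivenko–Cantelli, i.e. $\|P_n-P_g\|_{\mathcal F_j}\overset{\text{a.s.*}}{\to}0$; (6) there exists a constant $C>0$ such that $\mathbb E^*\|G_n\|_{\mathcal F_j}\le C$ for all $j=0,\ldots,l$ and all $n\in\mathbb N$. Then $\sqrt n\,(val(\mathcal P_n)-val(\mathcal P))=O_{\mathbb P^*}(1)$, i.e. for every $\varepsilon>0$ there exists $K>0$ such that $$\limsup_{n\to\infty}\mathbb P^*\big(|\sqrt n\,(val(\mathcal P_n)-val(\mathcal P))|\ge K\big)\le\varepsilon.$$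
   Context: Setting. $\mathcal X$ is a subset of a Euclidean space, $\phi_0,\ldots,\phi_l:\mathcal X\to\mathbb R$ are known functions, $0\le m\le l$, and $\mu_1,\ldots,\mu_l\in\mathbb R$. One of $\phi_1,\ldots,\phi_l$ is the indicator $I(x\in\mathcal X)$ (total mass constraint). $\mathcal F$ is a class of nonnegative functions (densities whose total mass is prescribed only through the moment constraints) on $\mathcal X$. $g$ is a fixed positive probability density on $\mathcal X$, $X$ has density $g$, $\mathbb E_g$ is expectation under $g$, and $\mathcal L=\{f/g:f\in\mathcal F\}$. Problem $(\mathcal P)$: $\sup_{L\in\mathcal L}\mathbb E_g[\phi_0(X)L(X)]$ subject to $\mathbb E_g[\phi_j(X)L(X)]\le\mu_j$ for $j=1,\ldots,m$ and $\mathbb E_g[\phi_j(X)L(X)]=\mu_j$ for $j=m+1,\ldots,l$. Problem $(\mathcal P_n)$: $\sup_{L\in\mathcal L}\frac1n\sum_{i=1}^n\phi_0(X_i)L(X_i)$ subject to $\frac1n\sum_{i=1}^n\phi_j(X_i)L(X_i)\le\mu_j$ for $j=1,\ldots,m$ and $\frac1n\sum_{i=1}^n\phi_j(X_i)L(X_i)=\mu_j$ for $j=m+1,\ldots,l$. $val(\cdot)$ denotes the optimal value in $[-\infty,\infty]$ (with $\sup\emptyset=-\infty$). If $l=m$, the interior point condition is vacuous. Empirical process notation. $P_g$ is the law of $X$, $P_n=\frac1n\sum_{i=1}^n\delta_{X_i}$, $P_gh=\mathbb E_g[h(X)]$, $P_nh=\frac1n\sum_{i=1}^nh(X_i)$,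 $G_n=\sqrt n(P_n-P_g)$, and $\|Q\|_{\mathcal H}=\sup\{|Qh|:h\in\mathcal H\}$ for a signed measure $Q$ and a function class $\mathcal H$. An envelope of $\mathcal H$ is a function $H$ with $\sup_{h\in\mathcal H}|h(x)|\le H(x)$ for all $x$. Outer probability. On the probability space $(\Omega,\mathcal G,\mathbb P)$: $\mathbb P^*(B)=\inf\{\mathbb P(A):A\supset B,\ A\in\mathcal G\}$ for arbitrary $B\subset\Omega$; for an arbitrary map $T:\Omega\to[-\infty,\infty]$, $\mathbb E^*[T]=\inf\{\mathbb E[U]:U\ge T,\ U\text{ measurable},\ \mathbb E[U]\text{ well-defined in }[-\infty,\infty]\}$, and $T^*$ denotes the minimal measurable majorant of $T$ ($T^*$ is measurable, $T^*\ge T$, and $T^*\le U$ a.s. for every measurable $U$ with $U\ge T$ a.s.). For arbitrary maps, $Z_n\overset{\text{a.s.*}}{\to}Z$ means $|Z_n-Z|^*\to0$ almost surely. *)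

(* Defs.v *)
From HB Require Import structures.
From mathcomp Require Import all_boot all_order all_algebra.
From mathcomp Require Import all_classical all_reals all_analysis.
From mathcomp Require Import measurable_realfun.

Set Implicit Arguments.
Unset Strict Implicit.
Unset Printing Implicit Defensive.

Import Order.TTheory GRing.Theory Num.Theory.
Import numFieldNormedType.Exports.

Local Open Scope classical_set_scope.
Local Open Scope ring_scope.

Notation euclid R d := (d.-tuple (measurableTypeR R)).

Section lebesgue_euclid.
Context {R : realType}.
Local Open Scope ereal_scope.

Let tcons n (x : measurableTypeR R * euclid R n) : euclid R n.+1 :=
  [tuple of x.1 :: x.2].

Let measurable_tcons n : measurable_fun [set: _] (@tcons n).
Proof. by apply: measurable_cons; [exact: measurable_fst|exact: measurable_snd]. Qed.

Section step.
Context n (mu : {sigma_finite_measure set (euclid R n) -> \bar R}).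

Definition lebesgue_step : set (euclid R n.+1) -> \bar R :=
  pushforward (lebesgue_measure \x mu) (@tcons n).

Let step0 : lebesgue_step set0 = 0.
Proof. by rewrite /lebesgue_step /pushforward preimage_set0 measure0. Qed.

Let step_ge0 A : 0 <= lebesgue_step A.
Proof. exact: (measure_ge0 (lebesgue_measure \x mu)). Qed.

Let measurable_step (A : set (euclid R n.+1)) :
  measurable A -> measurable (@tcons n @^-1` A).
Proof. by move=> mA; rewrite -[X in measurable X]setTI; exact: measurable_tcons. Qed.

Let step_sigma_additive : semi_sigma_additive lebesgue_step.
Proof.
move=> F mF tF mUF; rewrite /lebesgue_step /pushforward preimage_bigcup.
apply: measure_semi_sigma_additive.
- by move=> k; exact: measurable_step.
- apply/trivIsetP => /= i j _ _ ij; rewrite -preimage_setI.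
  by move/trivIsetP : tF => /(_ _ _ _ _ ij) ->//; rewrite preimage_set0.
- by rewrite -preimage_bigcup; exact: measurable_step.
Qed.

HB.instance Definition _ :=
  isMeasure.Build _ _ _ lebesgue_step step0 step_ge0 step_sigma_additive.

Let tsplit (t : euclid R n.+1) : measurableTypeR R * euclid R n :=
  (thead t, [tuple of behead t]).

Let tconsK : cancel (@tcons n) tsplit.
Proof.
by move=> [x t]; congr pair; apply/val_inj.
Qed.

Let measurable_tsplit : measurable_fun [set: _] tsplit.
Proof.
apply/measurable_fun_pairP; split; first exact: measurable_tnth.
exact: measurable_behead.
Qed.

Let step_sigma_finite : sigma_finite setT lebesgue_step.
Proof.
have /sigma_finiteP[F [TF ndF Foo]] := sigma_finiteT (@lebesgue_measure R).
have /sigma_finiteP[G [TG ndG Goo]] := sigma_finiteT mu.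
exists (fun k => tsplit @^-1` (F k `*` G k)).
  apply/esym; rewrite -subTset => t _.
  have [i _ Fi] : (\bigcup_i F i) (tsplit t).1 by rewrite -TF.
  have [j _ Gj] : (\bigcup_i G i) (tsplit t).2 by rewrite -TG.
  exists (maxn i j) => //; split.
    by move: Fi; exact/subsetPset/ndF/leq_maxl.
  by move: Gj; exact/subsetPset/ndG/leq_maxr.
move=> k; have [mF Fk] := Foo k; have [mG Gk] := Goo k; split.
  rewrite -[X in measurable X]setTI.
  by apply: measurable_tsplit => //; exact: measurableX.
rewrite /lebesgue_step /pushforward -comp_preimage.
rewrite (_ : tsplit \o _ = id) ?preimage_id; last first.
  by apply/funext => x /=; rewrite tconsK.
by rewrite product_measure1E// lte_mul_pinfty// ge0_fin_numE.
Qed.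

HB.instance Definition _ :=
  Measure_isSigmaFinite.Build _ _ _ lebesgue_step step_sigma_finite.

End step.

Fixpoint lebesgue_euclid n : {sigma_finite_measure set (euclid R n) -> \bar R} :=
  match n with
  | 0 => [the {sigma_finite_measure set (euclid R 0) -> \bar R} of \d_[tuple]]
  | n'.+1 => [the {sigma_finite_measure set (euclid R n'.+1) -> \bar R} of
               lebesgue_step (lebesgue_euclid n')]
  end.

Lemma lebesgue_euclid_box n (A : 'I_n -> set (measurableTypeR R)) :
  (forall i, measurable (A i)) ->
  lebesgue_euclid n [set x | forall i, A i (tnth x i)] =
    \prod_(i < n) lebesgue_measure (A i).
Proof.
elim: n A => [|n ih] A mA.
  by rewrite big_ord0 /= diracE mem_set// => -[].
rewrite big_ord_recl -ih//= /lebesgue_step /pushforward.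
rewrite -product_measure1E//; last first.
  rewrite (_ : mkset _ = \bigcap_(i in [set: 'I_n])
      ((fun x => tnth x i) @^-1` A (lift ord0 i))).
    apply: fin_bigcap_measurable => // i _.
    by rewrite -[X in measurable X]setTI; exact: measurable_tnth.
  by apply/seteqP; split => [x h i _|x h i]; exact: h.
congr (_ _); apply/seteqP; split => [[x t] h|[x t] [/= h0 h] i].
  split=> [|i]; first exact: (h ord0).
  by have := h (lift ord0 i); rewrite /= tnthS.
have [j ->|->//] := unliftP ord0 i.
by rewrite /= tnthS.
Qed.

End lebesgue_euclid.

Section outer.
Context d (Omega : measurableType d) (R : realType) (P : probability Omega R).
Local Open Scope ereal_scope.

Definition outer_prob (B : set Omega) : \bar R :=
  ereal_inf [set P A | A in [set A | measurable A /\ B `<=` A]].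

Definition expectation_defined (U : Omega -> \bar R) : Prop :=
  \int[P]_w U^\+ w < +oo \/ \int[P]_w U^\- w < +oo.

Definition outer_expectation (T : Omega -> \bar R) : \bar R :=
  ereal_inf [set \int[P]_w U w | U in
    [set U : Omega -> \bar R | [/\ measurable_fun [set: Omega] U, (forall w, T w <= U w) &
                 expectation_defined U]]].

(* U is a version of T^*, which exists and is determined up to a P-null set; so
   the choice of versions in as_star_cvg is immaterial. *)
Definition minimal_measurable_majorant (T U : Omega -> \bar R) : Prop :=
  [/\ measurable_fun [set: Omega] U, (forall w, T w <= U w) &
      forall V : Omega -> \bar R, measurable_fun [set: Omega] V ->
        {ae P, forall w, T w <= V w} -> {ae P, forall w, U w <= V w}].

Definition as_star_cvg (Z : nat -> Omega -> \bar R) (Z0 : Omega -> \bar R) :=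
  exists U : nat -> Omega -> \bar R,
    (forall n, minimal_measurable_majorant (fun w => `|Z n w - Z0 w|) (U n)) /\
    {ae P, forall w, U n w @[n --> \oo] --> 0}.

Definition mutually_independent d' (T : measurableType d')
    (X : nat -> {RV P >-> T}) : Prop :=
  forall (s : seq nat) (A : nat -> set T), uniq s ->
    (forall i, measurable (A i)) ->
    P (\bigcap_(i in [set` s]) (X i @^-1` A i)) =
      \prod_(i <- s) P (X i @^-1` A i).

End outer.

Section empirical.
Context {R : realType} {T : Type}.

(* P_n h for the points X 0, ..., X (n - 1) *)
Definition empirical_mean (X : nat -> T) (n : nat) (h : T -> R) : R :=
  n%:R^-1 * \sum_(i < n) h (X i).

Definition sup_norm (Q : (T -> R) -> R) (H : set (T -> R)) : \bar R :=
  ereal_sup [set `|Q h|%:E | h in H].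

End empirical.

Section moment_problem.
Context {R : realType} {T : Type}.
Variables (l m : nat) (phi : nat -> T -> R) (mu : nat -> R).

(* The moment problem over LL in which the functional I plays the role of the
   expectation: I = E_g gives (P), I = P_n gives (P_n). The entry mu 0 and the
   entries of phi and mu of index > l are unused. *)
Definition feasible (LL : set (T -> R)) (I : (T -> R) -> R) (L : T -> R) :=
  [/\ LL L,
      forall j, (1 <= j <= m)%N -> I (phi j \* L) <= mu j &
      forall j, (m < j <= l)%N -> I (phi j \* L) = mu j].

Definition moment_val (LL : set (T -> R)) (I : (T -> R) -> R) : \bar R :=
  ereal_sup [set (I (phi 0%N \* L))%:E | L in feasible LL I].

End moment_problem.

Section density.
Context {R : realType} {d : nat}.
Implicit Types (XX : set (euclid R d)) (g : euclid R d -> R).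

Definition positive_density XX g : Prop :=
  [/\ measurable_fun XX g, (forall x, XX x -> 0 < g x) &
      (\int[lebesgue_euclid d]_(x in XX) (g x)%:E = 1)%E].

Definition has_density d' (Omega : measurableType d') (P : probability Omega R)
    (X : {RV P >-> euclid R d}) XX g : Prop :=
  (forall w, XX (X w)) /\
  forall A, measurable A ->
    P (X @^-1` A) = (\int[lebesgue_euclid d]_(x in XX `&` A) (g x)%:E)%E.

Definition g_integrable XX g (h : euclid R d -> R) : Prop :=
  (lebesgue_euclid d).-integrable XX (EFin \o (h \* g)).

(* E_g[h(X)]; the real-valued integral, meaningful when h is g_integrable. *)
Definition E_g XX g (h : euclid R d -> R) : R :=
  \int[lebesgue_euclid d]_(x in XX) (h x * g x).

(* {f / g : f in F}. Functions on XX are represented by their extension by 0 to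
   the whole space, so that distinct elements differ on XX. *)
Definition likelihood_ratios XX g (F : set (euclid R d -> R)) :
    set (euclid R d -> R) :=
  [set (fun x => f x / g x) \_ XX | f in F].

Definition G_n XX g (X : nat -> euclid R d) (n : nat) (h : euclid R d -> R) : R :=
  Num.sqrt n%:R * (empirical_mean X n h - E_g XX g h).

End density.

(* Main.v *)
(* Moving a point feasible for one set of moments by O(eta) towards suitable
   anchor points makes it feasible for any moments at uniform distance eta, at
   the cost of O(eta) in the objective; hence
   |val(P_n) - val(P)| <= M max_j ||P_n - P_g||_{F_j} as soon as the right-hand
   norms are small. The equality constraints are handled by a cube argument:
   points whose equality moments lie in the 2^(l-m) orthants around mu keep
   doing so under perturbation, and some convex combination of them hits mu
   exactly. Markov's inequality applied to the measurable majorants provided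
   by (6) bounds the norms by K / sqrt n outside an event of probability at
   most eps. *)

Require Import Defs.
From HB Require Import structures.
From mathcomp Require Import all_boot all_order all_algebra.
From mathcomp Require Import all_classical all_reals all_analysis.
From mathcomp Require Import measurable_realfun ring lra.

Import Order.TTheory GRing.Theory Num.Theory.
Import numFieldNormedType.Exports.

Local Open Scope classical_set_scope.
Local Open Scope ring_scope.
Local Open Scope convex_scope.

Set Implicit Arguments.
Unset Strict Implicit.
Unset Printing Implicit Defensive.

(** * Convex sets and functionals affine on them *)

(** Affinity is asked only on [C]: the integral respects convex combinations on integrable products,
    not on arbitrary functions. *)
Definition affine_on (R : realType) (V : lmodType R)
    (C : set (convex_lmodType V)) (c : V -> R) : Prop :=
  forall (x y : convex_lmodType V) (t : {i01 R}), C x -> C y ->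
    c (x <| t |> y) = t%:num * c x + (1 - t%:num) * c y.

(** The point [z] is chosen before [c], so one mixture serves all the moments at once, with a plain
    real weight. *)
Lemma convex_combination (R : realType) (V : lmodType R)
    (C : set (convex_lmodType V)) (t : R) (x y : V) :
  convex_set C -> 0 <= t -> t <= 1 -> C x -> C y ->
  exists2 z, C z & forall c : V -> R, affine_on C c ->
    c z = t * c x + (1 - t) * c y.
Proof.
move=> cC t0 t1 Cx Cy; exists ((x : convex_lmodType V) <| Itv01 t0 t1 |> y).
  by apply: set_mem; apply: cC; exact: mem_set.
by move=> c /(_ x y (Itv01 t0 t1) Cx Cy).
Qed.

Lemma exists_convex_zero (R : realFieldType) (u v : R) : 0 <= u -> v <= 0 ->
  exists t, [/\ 0 <= t, t <= 1 & t * u + (1 - t) * v = 0].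
Proof.
move=> u0 v0; have [uv|uv] := eqVneq u v.
  by exists 0; split => //; move: u0; rewrite uv; lra.
have uv0 : 0 < u - v by rewrite lt0r subr_eq0 uv /=; lra.
exists (- v / (u - v)); split.
- by rewrite divr_ge0 ?oppr_ge0 // ltW.
- by rewrite ler_pdivrMr// mul1r; lra.
- by field; rewrite subr_eq0.
Qed.

(* Induction on k: averaging the two points whose signs differ only at index k
   kills that coordinate and preserves the other signs. *)
Lemma convex_common_zero (R : realType) (V : lmodType R)
    (C : set (convex_lmodType V)) (k : nat) (c : nat -> V -> R) :
  convex_set C -> (forall i, (i < k)%N -> affine_on C (c i)) ->
  (forall s : nat -> bool, exists2 x, C x &
     forall i, (i < k)%N -> 0 <= (-1) ^+ s i * c i x) ->
  exists2 x, C x & forall i, (i < k)%N -> c i x = 0.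
Proof.
elim: k C => [|k ih] C cC cA sC.
  by have [x Cx _] := sC (fun=> false); exists x.
have Ak : affine_on C (c k) by exact: cA.
have [| | |x [Cx xk] x0] := ih [set x | C x /\ c k x = 0].
- move=> x y t /set_mem[Cx x0] /set_mem[Cy y0]; apply/mem_set; split.
    by apply: set_mem; apply: cC; exact: mem_set.
  by rewrite Ak// x0 y0 !mulr0 addr0.
- by move=> i ik x y t [Cx _] [Cy _]; apply: cA => //; exact: ltnW.
- move=> s.
  have [x Cx xs] := sC (fun i => (i != k) && s i).
  have [y Cy ys] := sC (fun i => (i == k) || s i).
  have x0 : 0 <= c k x by have := xs k (ltnSn k); rewrite eqxx /= mul1r.
  have y0 : c k y <= 0.
    by have := ys k (ltnSn k); rewrite eqxx /= mulN1r oppr_ge0.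
  have [t [t0 t1 txy]] := exists_convex_zero x0 y0.
  have [z Cz zE] := convex_combination cC t0 t1 Cx Cy.
  exists z; first by split => //; rewrite zE.
  move=> i ik; have ik' := ltnW ik; rewrite zE; last exact: cA.
  have := xs i ik'; have := ys i ik'; rewrite (ltn_eqF ik) /= => yi xi.
  rewrite mulrDr !(mulrCA ((-1) ^+ s i)).
  by rewrite addr_ge0// mulr_ge0// subr_ge0.
exists x => // i; rewrite ltnS leq_eqVlt => /predU1P[->//|]; exact: x0.
Qed.

(** * Repairing feasibility and stability of the optimal value *)

(* Slater and interior point conditions in one, with common margin s; unlike the
   two original conditions this one survives perturbation of the moments. *)
Definition anchored (R : realType) (V : Type) (l m : nat) (C : set V)
    (mu : nat -> R) (c : nat -> V -> R) (s B : R) : Prop :=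
  forall e : nat -> bool, exists x, [/\ C x,
    forall j, (1 <= j <= m)%N -> c j x <= mu j - s,
    forall j, (m < j <= l)%N -> s <= (-1) ^+ e j * (c j x - mu j) &
    - B <= c 0%N x].

Lemma anchored_perturb (R : realType) (V : Type) (l m : nat) (C : set V)
    (mu : nat -> R) (a b : nat -> V -> R) (s B : R) :
  (m <= l)%N -> anchored l m C mu a (s *+ 2) B ->
  (forall j x, (j <= l)%N -> C x -> `|a j x - b j x| <= s) ->
  anchored l m C mu b s (B + s).
Proof.
move=> ml anc ab e; have [x [Cx xm xl x0]] := anc e.
exists x; split => //.
- move=> j /[dup] /xm jx /andP[_ jm].
  have := ab j x (leq_trans jm ml) Cx; rewrite ler_distl => /andP[? ?]; lra.
- move=> j /[dup] /xl jx /andP[_ jl].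
  have := ab j x jl Cx; rewrite ler_distl => /andP[? ?].
  by move: jx; case: (e j); rewrite ?expr1 ?expr0; lra.
- have := ab 0%N x (leq0n _) Cx; rewrite ler_distl => /andP[? ?]; lra.
Qed.

(** Put weight [t = eta / s] on an anchor and [1 - t] on [y]. The anchor's margin contributes
    [t * s = eta], which outweighs the violation [(1 - t) * eta] of [y]: the inequalities hold, and
    each equality moment lies on the side of [mu j] prescribed by the anchor. [convex_common_zero]
    then makes the equalities exact. *)
Lemma feasible_repair (R : realType) (V : lmodType R) (l m : nat)
    (C : set (convex_lmodType V)) (mu : nat -> R) (c : nat -> V -> R)
    (s B eta : R) (y : V) :
  (m <= l)%N -> convex_set C -> (forall j, (j <= l)%N -> affine_on C (c j)) ->
  anchored l m C mu c s B -> 0 < s -> 0 <= eta <= s -> C y ->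
  (forall j, (1 <= j <= m)%N -> c j y <= mu j + eta) ->
  (forall j, (m < j <= l)%N -> `|c j y - mu j| <= eta) ->
  exists x, [/\ C x, forall j, (1 <= j <= m)%N -> c j x <= mu j,
    forall j, (m < j <= l)%N -> c j x = mu j &
    (1 - eta / s) * c 0%N y - eta / s * B <= c 0%N x].
Proof.
move=> ml cC cA anc s0 /andP[eta0 etas] Cy ym yl.
set t := eta / s.
have t0 : 0 <= t by rewrite divr_ge0// ltW.
have t1 : t <= 1 by rewrite ler_pdivrMr// mul1r.
have ts : t * s = eta by rewrite divfK// gt_eqF.
(* The inequalities and the objective bound are built into the convex set [D], so they survive the
   search for a common zero. *)
pose D : set (convex_lmodType V) := [set x | [/\ C x,
  forall j, (1 <= j <= m)%N -> c j x <= mu j &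
  (1 - t) * c 0%N y - t * B <= c 0%N x]].
have cD : convex_set D.
  move=> x z u /set_mem[Cx xm x0] /set_mem[Cz zm z0]; apply/mem_set.
  have u0 : 0 <= u%:num by [].
  have u1 : 0 <= 1 - u%:num by rewrite subr_ge0.
  split; first by apply: set_mem; apply: cC; exact: mem_set.
    move=> j /[dup] jm /andP[_ jm']; rewrite cA//; last exact: leq_trans ml.
    have := zm j jm; have := xm j jm; nra.
  rewrite cA//; nra.
have [| |x [Cx xm x0] xl] :=
    convex_common_zero (k := l - m)
      (c := fun i x => c (m + i.+1)%N x - mu (m + i.+1)%N) cD.
- move=> i ilm x z u [Cx _ _] [Cz _ _]; rewrite cA//; last first.
    by rewrite addnS -ltn_subRL.
  ring.
(* The shift by [m.+1] turns signs of equality constraints, indexed from [m.+1], into signs indexed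
   from 0. *)
- move=> e; have [x [Cx xm xl x0]] := anc (fun j => e (j - m.+1)%N).
  have [z Cz zE] := convex_combination cC t0 t1 Cx Cy.
  exists z; first split=> //.
  + move=> j /[dup] jm /andP[_ jm']; rewrite zE; last exact/cA/(leq_trans jm').
    have := xm j jm; have := ym j jm; nra.
  + rewrite zE; last exact: cA; nra.
  + move=> i ilm; have mil : (m + i.+1 <= l)%N by rewrite addnS -ltn_subRL.
    have mil' : (m < m + i.+1 <= l)%N by rewrite mil andbT addnS ltnS leq_addr.
    rewrite zE; last exact: cA.
    have := xl _ mil'; have := yl _ mil'.
    rewrite addnS subSS addKn -addnS ler_norml => /andP[? ?].
    by case: (e i); rewrite ?expr1 ?expr0; nra.
exists x; split => // j /andP[mj jl].
have jE : (m + (j - m.+1).+1)%N = j by rewrite addnS -addSn subnKC.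
have := xl (j - m.+1)%N; rewrite jE => /(_ _)/eqP; rewrite subr_eq0 => xj.
by apply/eqP/xj; rewrite ltn_subLR// addSn subnKC// ltnW.
Qed.

(** Repair is used both ways: a point feasible for [J] is made feasible for [I], which bounds the
    value of [J] above, and conversely for the lower bound. *)
Lemma moment_val_stable (R : realType) (T : Type) (l m : nat)
    (phi : nat -> T -> R) (mu : nat -> R) (LL : set (T -> R))
    (I J : (T -> R) -> R) (s B v eta : R) :
  let moment I j L := I (phi j \* L) in
  (m <= l)%N -> convex_set (LL : set (convex_lmodType (T -> R^o))) ->
  (forall j, (j <= l)%N ->
    affine_on (LL : set (convex_lmodType (T -> R^o))) (moment I j)) ->
  (forall j, (j <= l)%N ->
    affine_on (LL : set (convex_lmodType (T -> R^o))) (moment J j)) ->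
  anchored l m LL mu (moment I) (s *+ 2 *+ 2) B -> 0 <= B -> 0 < s ->
  0 <= eta <= s ->
  (forall j L, (j <= l)%N -> LL L -> `|moment I j L - moment J j L| <= eta) ->
  moment_val l m phi mu LL I = v%:E ->
  (`|moment_val l m phi mu LL J - v%:E| <=
     (eta * (1 + (`|v| + (B + s *+ 2)) / s))%:E)%E.
Proof.
move=> moment ml cL aI aJ ancI B0 s0 /andP[eta0 etas] IJ vI.
have s2 : 0 < s *+ 2 by rewrite mulrn_wgt0.
(* Comparing [moment I] with itself only weakens its constants, so that both functionals share the
   margin [s *+ 2] and the bound [B + s *+ 2]. *)
have ancI2 : anchored l m LL mu (moment I) (s *+ 2) (B + s *+ 2).
  by apply: (anchored_perturb ml ancI) => j L _ _; rewrite subrr normr0 ltW.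
have ancJ2 : anchored l m LL mu (moment J) (s *+ 2) (B + s *+ 2).
  by apply: (anchored_perturb ml ancI) => j L jl /(IJ _ _ jl)/le_trans; apply; lra.
have eta2 : 0 <= eta <= s *+ 2 by rewrite eta0 /=; lra.
set W := `|v| + (B + s *+ 2).
set t := eta / (s *+ 2).
have W0 : 0 <= W by rewrite !addr_ge0// ltW.
have t0 : 0 <= t by rewrite divr_ge0// ltW.
(* The margin [s *+ 2] against [eta <= s] keeps [1 / (1 - t)] at most 2; this is the factor 2 in
   [2 * t * W] below. *)
have t2 : t * 2 <= 1.
  rewrite /t -mulr_natr mulrAC -[X in _ <= X](divff (lt0r_neq0 s2)).
  by rewrite ler_pM2r ?invr_gt0//; lra.
have tE : eta * (1 + W / s) = eta + 2 * t * W.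
  by rewrite /t -mulr_natr; field; rewrite gt_eqF.
have feasL L : feasible l m phi mu LL I L -> moment I 0%N L <= v.
  by move=> fL; rewrite -lee_fin -vI; apply: ereal_sup_ubound; exists L.
have vW : `|v| = W - (B + s *+ 2) by rewrite /W addrK.
have [vl vu] : - `|v| <= v /\ v <= `|v| by split; [rewrite lerNl ler_normr lexx orbT|exact: ler_norm].
have up : (moment_val l m phi mu LL J <= (v + eta * (1 + W / s))%:E)%E.
  apply: ge_ereal_sup => _ [L [LL_ Lm Ll] <-]; rewrite lee_fin tE.
  have [||x [Cx xm xl x0]] := feasible_repair ml cL aI ancI2 s2 eta2 LL_.
  - move=> j /[dup] /Lm jm /andP[_ jm'].
    have := IJ j L (leq_trans jm' ml) LL_; rewrite ler_distl /moment => /andP[_ ?].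
    lra.
  - move=> j /[dup] /Ll jm /andP[_ jl]; rewrite -jm.
    exact: IJ.
  have := feasL x (And3 Cx xm xl).
  have := IJ 0%N L (leq0n _) LL_; rewrite ler_distl /moment => /andP[? ?].
  move: x0; rewrite -/t /moment => ? ?.
  have t1 : 0 < 1 - t by lra.
  have tv : t * v <= t * `|v| by rewrite ler_wpM2l.
  have tW : 0 <= (t * W) * (1 - t * 2) by rewrite mulr_ge0 ?subr_ge0// mulr_ge0.
  have JI : (1 - t) * (J (phi 0%N \* L) - eta) <= (1 - t) * I (phi 0%N \* L).
    by apply: ler_wpM2l => //; exact: ltW.
  have : (1 - t) * (J (phi 0%N \* L) - eta) <= (1 - t) * (v + 2 * t * W).
    by rewrite vW in tv; lra.
  by rewrite ler_pM2l// => ?; lra.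
have lo : ((v - eta * (1 + W / s))%:E <= moment_val l m phi mu LL J)%E.
  rewrite EFinB leeBlDr// -vI.
  apply: ge_ereal_sup => _ [L fL <-]; have [LL_ Lm Ll] := fL.
  have [||x [Cx xm xl x0]] := feasible_repair ml cL aJ ancJ2 s2 eta2 LL_.
  - move=> j /[dup] /Lm jm /andP[_ jm'].
    have := IJ j L (leq_trans jm' ml) LL_; rewrite ler_distl /moment => /andP[? _].
    lra.
  - move=> j /[dup] /Ll jm /andP[_ jl]; rewrite -jm distrC.
    exact: IJ.
  rewrite -leeBlDr// -EFinB.
  apply: (@le_trans _ _ (moment J 0%N x)%:E); last first.
    by apply: ereal_sup_ubound; exists x.
  rewrite lee_fin tE.
  have := feasL L fL.
  have := IJ 0%N L (leq0n _) LL_; rewrite ler_distl /moment => /andP[? ?].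
  move: x0; rewrite -/t /moment => ? ?.
  have t1 : 0 <= 1 - t by lra.
  have tv : t * I (phi 0%N \* L) <= t * v by rewrite ler_wpM2l.
  have tv' : t * v <= t * `|v| by rewrite ler_wpM2l.
  have tW : 0 <= t * W by rewrite mulr_ge0.
  have IJ0 : (1 - t) * (I (phi 0%N \* L) - eta) <= (1 - t) * J (phi 0%N \* L).
    by rewrite ler_wpM2l//; lra.
  have te : 0 <= t * eta by rewrite mulr_ge0.
  by rewrite vW in tv'; lra.
(* The two finite bounds exclude the values [+oo] and [-oo]. *)
move: up lo; case: (moment_val _ _ _ _ _ J) => [r| |]//=.
rewrite !lee_fin => ? ?; rewrite ler_distl; lra.
Qed.

(** * Outer expectation, limits superior and affinity of the moments *)

(** Markov's inequality for a measurable majorant [U] of [Z]. The strict bound on the infimum yields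
    such a [U] with integral below [C], even if the infimum is not attained. *)
Lemma outer_expectation_tail (d : measure_display) (T : measurableType d)
    (R : realType) (P : probability T R) (Z : T -> \bar R) (C K : R) :
  (forall w, 0 <= Z w)%E -> (outer_expectation P Z < C%:E)%E -> 0 < K ->
  exists A : set T, [/\ measurable A, (P A <= (C / K)%:E)%E &
    forall w, ~ A w -> (Z w < K%:E)%E].
Proof.
move=> Z0 ZC K0.
have [_ [U [mU ZU _] <-] UC] : exists2 x, [set \int[P]_w U w | U in
    [set U : T -> \bar R | [/\ measurable_fun [set: T] U, (forall w, Z w <= U w) &
                 expectation_defined P U]]]%E x & (x < C%:E)%E.
  exact: ereal_inf_lt.
have U0 w : (0 <= U w)%E by exact: le_trans (Z0 w) (ZU w).
exists [set w | K%:E <= `|U w|]%E; split.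
- rewrite -[X in measurable X]setTI.
  by apply: emeasurable_fun_c_infty => //; exact: measurableT_comp.
- have := @le_integral_comp_abse _ _ _ P _ measurableT U K id.
  move=> /(_ (@measurable_id _ _ _) (fun _ => id) (fun _ _ _ _ => id) mU K0).
  rewrite setTI => UK.
  rewrite mulrC EFinM lee_pdivlMl//; apply: (le_trans UK).
  by under eq_integral do rewrite gee0_abs//; exact: ltW.
- by move=> w /negP; rewrite -ltNge gee0_abs//; exact: le_lt_trans.
Qed.

Lemma limn_esup_le (R : realType) (u : nat -> \bar R) (N : nat) (x : \bar R) :
  (forall n, (N <= n)%N -> u n <= x)%E -> (limn_esup u <= x)%E.
Proof.
move=> ux; rewrite limn_esup_lim; apply: lime_le; first exact: is_cvg_esups.
exists N => // n /= Nn; apply: ge_ereal_sup => _ [k /= nk <-].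
by apply: ux; exact: leq_trans nk.
Qed.

Lemma uniform_slack (R : realFieldType) (m : nat) (f : nat -> R) :
  (forall j, (1 <= j <= m)%N -> 0 < f j) ->
  exists2 s, 0 < s & forall j, (1 <= j <= m)%N -> s <= f j.
Proof.
elim: m => [|m ih] f0; first by exists 1 => // -[].
have [j /andP[j0 jm]|s s0 sf] := ih; first by rewrite f0// j0 ltnW.
exists (Num.min s (f m.+1)); first by rewrite lt_min s0 f0 ?leqnn.
move=> j /andP[j0]; rewrite leq_eqVlt => /predU1P[->|jm].
  by rewrite ge_min lexx orbT.
by rewrite ge_min sf// j0 -ltnS.
Qed.

Lemma empirical_mean_affine (R : realType) (T : Type) (X : nat -> T) (n : nat)
    (f : T -> R) (C : set (convex_lmodType (T -> R^o))) :
  affine_on C (fun L => empirical_mean X n (f \* (L : T -> R))).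
Proof.
move=> x y t _ _; rewrite /empirical_mean [X in _ = X + _]mulrCA.
rewrite [X in _ = _ + X]mulrCA -mulrDr; congr (_ * _).
rewrite !mulr_sumr -big_split /=.
apply: eq_bigr => i _ /=.
(* Unfolds the convex combination in the function space to pointwise arithmetic in [R]. *)
change (f (X i) * (t%:num * x (X i) + (1 - t%:num) * y (X i)) =
  t%:num * (f (X i) * x (X i)) + (1 - t%:num) * (f (X i) * y (X i))).
ring.
Qed.

Lemma E_g_affine (R : realType) (d : nat) (XX : set (euclid R d))
    (g f : euclid R d -> R) (C : set (convex_lmodType (euclid R d -> R^o))) :
  measurable XX -> (forall L, C L -> g_integrable XX g (f \* (L : _ -> R))) ->
  affine_on C (fun L => E_g XX g (f \* (L : _ -> R))).
Proof.
move=> mXX iC x y t /iC ix /iC iy; rewrite /E_g.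
rewrite -!RintegralZl// -RintegralD//.
- apply: eq_Rintegral => z _ /=.
  change (f z * (t%:num * x z + (1 - t%:num) * y z) * g z =
    t%:num * (f z * x z * g z) + (1 - t%:num) * (f z * y z * g z)).
  ring.
- by have := integrableZl mXX t%:num ix.
- by have := integrableZl mXX (1 - t%:num) iy.
Qed.

Lemma sup_norm_ge0 (R : realType) (T : Type) (Q : (T -> R) -> R)
    (H : set (T -> R)) (h : T -> R) : H h -> (0 <= sup_norm Q H)%E.
Proof.
move=> Hh; apply: (@le_trans _ _ `|Q h|%:E); first by rewrite lee_fin.
by apply: ereal_sup_ubound; exists h.
Qed.

(** * Anchors from the Slater and interior point conditions *)

(** Balls of row vectors are cubes, so the corners at half the radius belong to the open ball. *)
Lemma interior_orthants (R : realType) (V : Type) (l m : nat) (C : set V)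
    (mu : nat -> R) (c : nat -> V -> R) : (m < l)%N ->
  [set (\row_(k < l - m) c (m + k.+1)%N x : 'rV[R]_(l - m)) | x in C]°
    (\row_(k < l - m) mu (m + k.+1)%N) ->
  exists2 r, 0 < r & forall e : nat -> bool, exists2 x, C x &
    forall j, (m < j <= l)%N -> c j x = mu j + (-1) ^+ e j * r.
Proof.
move=> ml /nbhs_ballP[r /= r0 rC]; exists (r / 2); first exact: divr_gt0.
move=> e; have [|x Cx xE] :=
    rC (\row_k (mu (m + k.+1)%N + (-1) ^+ e (m + k.+1)%N * (r / 2))).
  split => // i k; rewrite !mxE /ball /= opprD addNKr normrN normrM normr_sign.
  by rewrite mul1r ger0_norm; lra.
exists x => // j /andP[mj jl].
have jm : (j - m.+1 < l - m)%N by rewrite ltn_subLR// addSn subnKC// ltnW.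
have := congr1 (fun M : 'rV_(l - m) => M 0 (Ordinal jm)) xE; rewrite !mxE /=.
by rewrite addnS -addSn subnKC.
Qed.

(** A small weight [t] on an orthant point and [1 - t] on the Slater point [x0] keeps half of the
    slack in the inequalities and moves each equality moment by exactly [t * r] in the chosen
    direction. *)
Lemma anchored_of_orthants (R : realType) (V : lmodType R) (l m : nat)
    (C : set (convex_lmodType V)) (mu : nat -> R) (c : nat -> V -> R)
    (r : R) (x0 : V) :
  (m <= l)%N -> convex_set C -> (forall j, (j <= l)%N -> affine_on C (c j)) ->
  C x0 -> (forall j, (1 <= j <= m)%N -> c j x0 < mu j) ->
  (forall j, (m < j <= l)%N -> c j x0 = mu j) -> 0 < r ->
  (forall e : nat -> bool, exists2 x, C x &
    forall j, (m < j <= l)%N -> c j x = mu j + (-1) ^+ e j * r) ->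
  exists s B, [/\ 0 < s, 0 <= B & anchored l m C mu c s B].
Proof.
move=> ml cC cA Cx0 x0m x0l r0 orth.
have [|s s0 sm] := @uniform_slack _ m (fun j => mu j - c j x0).
  by move=> j jm; rewrite subr_gt0 x0m.
(* Restricting sign patterns to ['I_l.+1] leaves finitely many orthant points, so that one [A]
   bounds all their moment deviations. *)
have /choice[L LP] (e : {ffun 'I_l.+1 -> bool}) : exists x, C x /\
    forall j, (m < j <= l)%N -> c j x = mu j + (-1) ^+ e (inord j) * r.
  by have [x Cx xE] := orth (fun j => e (inord j)); exists x.
pose A := \sum_(e : {ffun 'I_l.+1 -> bool}) \sum_(j < l.+1) `|c j (L e) - mu j|.
have LA e j : (j <= l)%N -> `|c j (L e) - mu j| <= A.
  rewrite -ltnS => jl; rewrite /A (bigD1 e)//= (bigD1 (Ordinal jl))//= -addrA.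
  by rewrite lerDl addr_ge0// sumr_ge0// => *; exact: sumr_ge0.
have A0 : 0 <= A by apply: sumr_ge0 => *; exact: sumr_ge0.
(* Chosen so that the inequality moments are at most [mu j - s + t * (A + s) = mu j - s / 2]. *)
pose t := s / (2 * (A + s)).
have As : 0 < A + s by lra.
have t0 : 0 < t by rewrite divr_gt0// mulr_gt0.
have tE : t * (A + s) = s / 2 by rewrite /t; field; rewrite gt_eqF.
have t1 : t <= 1.
  by rewrite ler_pdivrMr ?mulr_gt0//; lra.
pose B := A + `|mu 0%N| + `|c 0%N x0|.
exists (Num.min (s / 2) (t * r)), B; split.
- by rewrite lt_min divr_gt0// mulr_gt0.
- by rewrite !addr_ge0.
move=> e; pose e' := [ffun j : 'I_l.+1 => e j].
have [Ce eE] := LP e'.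
have [z Cz zE] := convex_combination cC (ltW t0) t1 Ce Cx0.
exists z; split => //.
- move=> j /[dup] jm /andP[_ jm']; have jl := leq_trans jm' ml.
  rewrite zE; last exact: cA.
  have := LA e' j jl; rewrite ler_norml => /andP[_ cA'].
  have := ler_wpM2l (ltW t0) cA'.
  have : (1 - t) * s <= (1 - t) * (mu j - c j x0).
    by apply: ler_wpM2l; [lra|exact: sm].
  have : Num.min (s / 2) (t * r) <= s / 2 by rewrite ge_min lexx.
  lra.
- move=> j /[dup] mjl /andP[_ jl]; rewrite zE; last exact: cA.
  rewrite eE// x0l// ffunE inordK ?ltnS// ge_min; apply/orP; right.
  rewrite le_eqVlt; apply/orP; left; apply/eqP.
  by case: (e j); rewrite ?expr1 ?expr0; ring.
- rewrite zE; last exact: cA.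
  have := LA e' 0%N isT; rewrite ler_norml => /andP[cA' _].
  have /andP[m1 m2] : - `|mu 0%N| <= mu 0%N <= `|mu 0%N| by rewrite -ler_norml.
  have /andP[x1 x2] : - `|c 0%N x0| <= c 0%N x0 <= `|c 0%N x0| by rewrite -ler_norml.
  have h1 : t * (- (A + `|mu 0%N|)) <= t * c 0%N (L e').
    by apply: ler_wpM2l; [exact: ltW|lra].
  have h2 : (1 - t) * (- `|c 0%N x0|) <= (1 - t) * c 0%N x0.
    by apply: ler_wpM2l; lra.
  have h3 : 0 <= (1 - t) * (A + `|mu 0%N|) by rewrite mulr_ge0 ?subr_ge0// addr_ge0.
  have h4 : 0 <= t * `|c 0%N x0| by rewrite mulr_ge0// ltW.
  by rewrite /B; lra.
Qed.

(** * Boundedness in outer probability at rate root n *)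

Unset Implicit Arguments.
Theorem theorem4 (R : realType) (d : nat)
    (dO : measure_display) (Omega : measurableType dO) (P : probability Omega R)
    (XX : set (euclid R d)) (mXX : measurable XX)
    (l m : nat) (hml : (m <= l)%N)
    (phi : nat -> euclid R d -> R) (mu : nat -> R)
    (hmass : exists2 j, (1 <= j <= l)%N & forall x, XX x -> phi j x = 1)
    (F : set (euclid R d -> R))
    (F0 : forall f, F f -> forall x, XX x -> 0 <= f x)
    (g : euclid R d -> R) (hg : positive_density XX g)
    (X : nat -> {RV P >-> euclid R d})
    (Xg : forall i, has_density (X i) XX g)
    (Xindep : mutually_independent X) :
  let LL := likelihood_ratios XX g F in
  let Eg := E_g XX g in
  let Pn w n := empirical_mean (fun i => X i w) n in
  let Gn w n := G_n XX g (fun i => X i w) n in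
  let FF j := [set phi j \* L | L in LL] in
  let val := moment_val l m phi mu LL Eg in
  let val_n n w := moment_val l m phi mu LL (Pn w n) in
  forall
    (H1 : forall L, LL L -> forall j, (j <= l)%N -> g_integrable XX g (phi j \* L))
    (H2 : convex_set (LL : set (convex_lmodType (euclid R d -> R^o))))
    (H3 : exists L0, [/\ LL L0,
        forall j, (1 <= j <= m)%N -> Eg (phi j \* L0) < mu j &
        forall j, (m < j <= l)%N -> Eg (phi j \* L0) = mu j])
    (H3' : (m < l)%N ->
        [set (\row_(k < l - m) Eg (phi (m + k.+1)%N \* L) : 'rV[R]_(l - m)) | L in LL]°
          (\row_(k < l - m) mu (m + k.+1)%N))
    (H4 : val \is a fin_num)
    (H5 : forall j, (j <= l)%N ->
        (exists2 H : euclid R d -> R, g_integrable XX g H &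
           forall h, FF j h -> forall x, XX x -> `|h x| <= H x) /\
        as_star_cvg P (fun n w => sup_norm (fun h => Pn w n h - Eg h) (FF j))
          (fun=> 0%E))
    (H6 : exists2 C : R, 0 < C & forall j, (j <= l)%N -> forall n, (0 < n)%N ->
        (outer_expectation P (fun w => sup_norm (Gn w n) (FF j)) <= C%:E)%E),
  forall eps : R, 0 < eps -> exists2 K : R, 0 < K &
    (limn_esup (fun n => outer_prob P
       [set w | K%:E <= `|(Num.sqrt n%:R)%:E * (val_n n w - val)|])
     <= eps%:E)%E.
Proof.
move=> LL Eg Pn Gn FF val val_n H1 H2 H3 H3' H4 H5 [C C0 H6] eps eps0.
have [L0 [LL0 L0m L0l]] := H3.
pose a j (L : euclid R d -> R) := Eg (phi j \* L).
have aA j : (j <= l)%N ->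
    affine_on (LL : set (convex_lmodType (euclid R d -> R^o))) (a j).
  by move=> jl; apply: E_g_affine => // L LL_; exact: H1.
have [r r0 orth] : exists2 r, 0 < r & forall e : nat -> bool, exists2 L, LL L &
    forall j, (m < j <= l)%N -> a j L = mu j + (-1) ^+ e j * r.
  (* Without equality constraints the sign condition is vacuous, and [L0] serves for every
     pattern. *)
  have [ml|lm] := ltnP m l; first exact: interior_orthants (H3' ml).
  exists 1 => // e; exists L0 => // j /andP[/leq_trans mj /mj].
  by rewrite ltnNge lm.
have [s [B [s0 B0 anc]]] := anchored_of_orthants hml H2 aA LL0 L0m L0l r0 orth.
(* The constant of [moment_val_stable] at [s / 4], as that lemma asks for a margin four times its
   parameter. *)
pose M := 1 + (`|fine val| + (B + (s / 4) *+ 2)) / (s / 4).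
have s4 : 0 < s / 4 by rewrite divr_gt0.
have M0 : 0 < M.
  by rewrite ltr_pwDl// divr_ge0 ?(ltW s4)// !addr_ge0// ltW.
have vE : val = (fine val)%:E by rewrite fineK.
(* Makes the union bound over [l.+1] events of probability at most [(C + 1) / K] equal to [eps];
   [C + 1] gives the strict bound that [outer_expectation_tail] needs. *)
pose K := l.+1%:R * (C + 1) / eps.
have K0 : 0 < K by rewrite divr_gt0// mulr_gt0// addr_gt0.
have MK0 : 0 < K * M by exact: mulr_gt0.
(* The extra 1 makes the bound [K * M] off the exceptional event strict. *)
exists (K * M + 1); first exact: addr_gt0.
have [N [N0 NS]] : exists N : nat, (0 < N)%N /\
    forall n, (N <= n)%N -> K / Num.sqrt n%:R <= s / 4.
  have x0 : 0 <= K / (s / 4) by rewrite divr_ge0// ltW.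
  exists (Num.bound ((K / (s / 4)) ^+ 2)); split.
    by rewrite -(ltr0n R); apply: le_lt_trans (archi_boundP _); exact: sqr_ge0.
  move=> n Nn; have xn : (K / (s / 4)) ^+ 2 < n%:R.
    by apply: lt_le_trans (archi_boundP (sqr_ge0 _)) _; rewrite ler_nat.
  have sn0 : 0 < Num.sqrt n%:R :> R.
    by rewrite sqrtr_gt0; exact: le_lt_trans (sqr_ge0 _) xn.
  rewrite ler_pdivrMr// mulrC -ler_pdivrMr// -(ger0_norm x0) -sqrtr_sqr.
  by rewrite ler_sqrt ltW// (le_lt_trans (sqr_ge0 _) xn).
apply: (@limn_esup_le _ _ N) => n Nn.
have n0 : (0 < n)%N by exact: leq_trans Nn.
have sn0 : 0 < Num.sqrt n%:R :> R by rewrite sqrtr_gt0 ltr0n.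
have /choice[A AP] (j : nat) : exists A : set Omega, (j <= l)%N ->
    [/\ measurable A, (P A <= ((C + 1) / K)%:E)%E &
      forall w, ~ A w -> (sup_norm (Gn w n) (FF j) < K%:E)%E].
  have [jl|lj] := leqP j l; last by exists set0.
  have [||A AP] := @outer_expectation_tail _ _ _ P
    (fun w => sup_norm (Gn w n) (FF j)) (C + 1) K _ _ K0; last by exists A.
  - by move=> w; apply: (@sup_norm_ge0 _ _ _ _ (phi j \* L0)); exists L0.
  - by apply: (le_lt_trans (H6 j jl n n0)); rewrite lte_fin ltrDl.
have mA i : (i < l.+1)%N -> measurable (A i) by rewrite ltnS => /AP[].
have mUA : measurable (\big[setU/set0]_(i < l.+1) A i).
  by apply: bigsetU_measurable => i _; exact: mA.
apply: (@le_trans _ _ (P (\big[setU/set0]_(i < l.+1) A i))); last first.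
  apply: (le_trans (Boole_inequality _ _)) => //.
  apply: (@le_trans _ _ (\sum_(i < l.+1) ((C + 1) / K)%:E)%E).
    by apply: lee_sum => i _; have [] := AP i (ltn_ord i).
  rewrite sumEFin lee_fin sumr_const card_ord /K -mulr_natl.
  rewrite le_eqVlt; apply/orP; left; apply/eqP; field.
  by rewrite !gt_eqF// ?ltr_pwDl// addr_gt0.
apply: ereal_inf_lbound; exists (\big[setU/set0]_(i < l.+1) A i) => //.
split => // w /=; rewrite -bigcup_mkord.
(* Outside all the [A j] every moment deviates by at most [K / Num.sqrt n%:R], so the stability
   bound applies. *)
apply: contraPP => Aw; apply/negP; rewrite -ltNge.
have close j L : (j <= l)%N -> LL L -> `|a j L - Pn w n (phi j \* L)| <= K / Num.sqrt n%:R.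
  move=> jl LL_; have [_ _ /(_ w)] := AP j jl.
  have nAj : ~ A j w by move=> Ajw; apply: Aw; exists j => //=.
  move=> /(_ nAj)/ltW; rewrite distrC ler_pdivlMr//.
  rewrite -lee_fin; apply: le_trans; apply: ereal_sup_ubound.
  exists (phi j \* L); first by exists L.
  by rewrite /Gn /G_n normrM (gtr0_norm sn0) mulrC.
have eta0 : 0 <= K / Num.sqrt n%:R <= s / 4 by rewrite NS// andbT divr_ge0// ltW.
have := @moment_val_stable _ _ l m phi mu LL Eg (Pn w n) (s / 4) B (fine val) _
  hml H2 aA _ _ B0 s4 eta0 close vE.
have -> : s / 4 *+ 2 *+ 2 = s by rewrite -mulrnA -mulr_natr; field.
move=> /(_ (fun j _ => @empirical_mean_affine _ _ _ _ _ _) anc).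
rewrite -vE -/(val_n n w) abseM [X in (X * _)%E]gee0_abs ?lee_fin ?sqrtr_ge0// => h.
apply: (@le_lt_trans _ _ (K * M)%:E); last by rewrite lte_fin ltrDl.
apply: (le_trans (lee_wpmul2l _ h)); first by rewrite lee_fin sqrtr_ge0.
rewrite -EFinM lee_fin mulrA [_ * (K / _)]mulrC divfK ?gt_eqF//.
Qed.
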